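(* For all $\alpha,\beta\in\mathbb{R}$, the point cloud manifold fractional harmonic matrices satisfy $F_M^{(\alpha)}F_M^{(\beta)}=F_M^{(\alpha+\beta)}$.
   Context: Discrete Laplace–Beltrami data. Let $P=\{p_1,\dots,p_N\}\subset\mathbb{R}^3$ be a point cloud sampled from a surface and let $t>0$. For each $i$, let $\hat T_{p_i}$ be the estimated tangent plane at $p_i$ (best-fitting plane to the points of $P$ in a ball around $p_i$), and let $b_{ii}>0$ be the area of the Voronoi cell of $p_i$ in the planar Voronoi diagram, on $\hat T_{p_i}$, of the projections of the points of $P$ in a ball $B(p_i,\delta)$. Let $B=\mathrm{diag}(b_{11},\dots,b_{NN})$ (mass matrix) and let $Q$ be the real symmetric matrix with $q_{ij}=\frac{b_{ii}b_{jj}}{4\pi t^2}\exp(-\|p_i-p_j\|^2/(4t))$ for $i\ne j$ and $q_{ii}=-\sum_{j\neq i}q_{ij}$. Let $H\in\mathbb{R}^{N\times N}$ be a matrix whose columns $H_i$ are generalized eigenvectors, $QH_i=-\lambda_i BH_i$, normalized so that $H^\top BH=I$. Fractional matrix. Put $F_M:=H^\top B^{1/2}$, a real orthogonal matrix. Fix a spectral decomposition $F_M=V\Omega V^*$ with $V$ unitary and $\Omega=\mathrm{diag}(\omega_1,\dots,\omega_N)$, $|\omega_i|=1$. For $\alpha\in\mathbb{R}$ put $F_M^{(\alpha)}:=V\Omega^\alpha V^*$ with $\Omega^\alpha=\mathrm{diag}(\omega_1^\alpha,\dots,\omega_N^\alpha)$, where $\omega_i^\alpha:=e^{\mathrm{i}\alpha\theta_i}$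 for a choice of real argument $\theta_i$ of $\omega_i$ ($\omega_i=e^{\mathrm{i}\theta_i}$) fixed once for all $\alpha$. *)

(* Defs.v *)
From mathcomp Require Import all_boot all_order all_algebra spectral.
From mathcomp Require Import complex.
From mathcomp Require Import all_classical all_reals all_analysis.
Set Implicit Arguments.
Unset Strict Implicit.
Unset Printing Implicit Defensive.
Import Order.TTheory GRing.Theory Num.Theory.
Local Open Scope classical_set_scope.
Local Open Scope ring_scope.
Local Open Scope sesquilinear_scope.
Local Open Scope complex_scope.

(* The Euclidean norm; the library's norm `|x| on row vectors is the sup norm. *)
Definition enorm (R : realType) n (x : 'rV[R]_n) : R :=
  Num.sqrt (\sum_k x 0 k ^+ 2).

(* An affine plane in R^3, given by a point and an orthonormal frame (the two
   rows of [frame]) of its direction. The notions below do not depend on which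
   origin and frame represent a given plane. *)
Record plane (R : realType) := Plane {
  origin : 'rV[R]_3;
  frame : 'M[R]_(2, 3);
  frame_orthonormal : frame *m frame^T = 1%:M }.

Definition chart (R : realType) (T : plane R) (s : 'rV[R]_2) : 'rV[R]_3 :=
  origin T + s *m frame T.

Definition proj_plane (R : realType) (T : plane R) (x : 'rV[R]_3) : 'rV[R]_3 :=
  chart T ((x - origin T) *m (frame T)^T).

(* The area of A :&: range (chart T), for A a set of points of R^3. *)
Definition plane_area (R : realType) (T : plane R) (A : set 'rV[R]_3) : \bar R :=
  product_measure1 (@lebesgue_measure R) (@lebesgue_measure R)
    [set s : R * R | A (chart T (\row_(k < 2) if k == 0 then s.1 else s.2))].

(* T minimizes the sum of squared orthogonal distances to the points of the
   cloud lying in the open ball of center p i and radius r. *)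
Definition best_fitting_plane (R : realType) N (p : 'I_N -> 'rV[R]_3)
    (i : 'I_N) (r : R) (T : plane R) : Prop :=
  forall T' : plane R,
    \sum_(j | enorm (p j - p i) < r) enorm (p j - proj_plane T (p j)) ^+ 2
    <= \sum_(j | enorm (p j - p i) < r) enorm (p j - proj_plane T' (p j)) ^+ 2.

(* The cell of p i in the Voronoi diagram, in the plane T, of the projections
   of the points of the cloud lying in the ball of center p i and radius delta. *)
Definition voronoi_cell (R : realType) N (p : 'I_N -> 'rV[R]_3) (delta : R)
    (T : plane R) (i : 'I_N) : set 'rV[R]_3 :=
  [set x | range (chart T) x /\
    forall j, enorm (p j - p i) < delta ->
      enorm (x - proj_plane T (p i)) <= enorm (x - proj_plane T (p j))].

Definition mass_mx (R : realType) N (b : 'rV[R]_N) : 'M[R]_N := diag_mx b.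

Definition mass_sqrt_mx (R : realType) N (b : 'rV[R]_N) : 'M[R]_N :=
  diag_mx (map_mx Num.sqrt b).

Definition stiffness_coef (R : realType) N (p : 'I_N -> 'rV[R]_3) (t : R)
    (b : 'rV[R]_N) (i j : 'I_N) : R :=
  b 0 i * b 0 j / (4 * pi * t ^+ 2) *
    expR (- (enorm (p i - p j) ^+ 2 / (4 * t))).

Definition stiffness_mx (R : realType) N (p : 'I_N -> 'rV[R]_3) (t : R)
    (b : 'rV[R]_N) : 'M[R]_N :=
  \matrix_(i, j) if i == j then - \sum_(k | k != i) stiffness_coef p t b i k
                 else stiffness_coef p t b i j.

Definition harmonic_mx (R : realType) N (H : 'M[R]_N) (b : 'rV[R]_N) : 'M[R]_N :=
  H^T *m mass_sqrt_mx b.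

(* e^(i x) for real x. *)
Definition expi (R : realType) (x : R) : R[i] := cos x +i* sin x.

(* The power omega^alpha of omega = e^(i theta) depends on the chosen argument
   theta, so it is the arguments that are passed here. *)
Definition frac_mx (R : realType) N (V : 'M[R[i]]_N) (theta : 'I_N -> R)
    (alpha : R) : 'M[R[i]]_N :=
  V *m diag_mx (\row_i expi (alpha * theta i)) *m V^t*.

(* Main.v *)
Require Import Defs.
From mathcomp Require Import all_boot all_order all_algebra spectral.
From mathcomp Require Import complex.
From mathcomp Require Import all_classical all_reals all_analysis.
Import Order.TTheory GRing.Theory Num.Theory.
Local Open Scope ring_scope.
Local Open Scope sesquilinear_scope.
Local Open Scope complex_scope.

(** All the matrices [frac_mx V theta alpha] are diagonalized by the same unitary
    [V]. In a product of two of them the inner factor [V^t* *m V] cancels, so that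
    only diagonal matrices are multiplied. As the arguments [theta] are the same
    for all exponents, their entries multiply by the addition formula for
    e^(i x), which is [expiD]: no ambiguity in the choice of a branch of the power
    can arise. *)

Lemma expiD (R : realType) (x y : R) : expi (x + y) = expi x * expi y.
Proof.
by rewrite /expi cosD sinD; apply/eqP; rewrite eq_complex /= eqxx addrC eqxx.
Qed.

Lemma frac_mx_mul (R : realType) (N : nat) (V : 'M[R[i]]_N)
    (theta : 'I_N -> R) (alpha beta : R) : V \is unitarymx ->
  frac_mx V theta alpha *m frac_mx V theta beta = frac_mx V theta (alpha + beta).
Proof.
move=> /unitarymxP V_unitary; rewrite /frac_mx !mulmxA.
(* [V_unitary] is V *m V^t* = 1, while the inner factor is V^t* *m V *)
rewrite -[_ *m V^t* *m V]mulmxA (mulmx1C V_unitary) mulmx1.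
rewrite -[V *m _ *m _]mulmxA mulmx_diag; congr (V *m diag_mx _ *m _).
by apply/rowP => k; rewrite !mxE mulrDl expiD.
Qed.

Theorem mainTheorem1 (R : realType) (N : nat)
  (p : 'I_N -> 'rV[R]_3) (p_inj : injective p)
  (t : R) (t_gt0 : 0 < t)
  (r : 'I_N -> R) (r_gt0 : forall i, 0 < r i)
  (T : 'I_N -> plane R) (T_fit : forall i, best_fitting_plane p i (r i) (T i))
  (delta : R) (delta_gt0 : 0 < delta)
  (b : 'rV[R]_N) (b_gt0 : forall i, 0 < b 0 i)
  (b_area : forall i, plane_area (T i) (voronoi_cell p delta (T i) i) = (b 0 i)%:E)
  (H : 'M[R]_N) (lambda : 'I_N -> R)
  (H_eigen : forall i,
     stiffness_mx p t b *m col i H = - lambda i *: (mass_mx b *m col i H))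
  (H_orth : H^T *m mass_mx b *m H = 1%:M)
  (V : 'M[R[i]]_N) (V_unitary : V \is unitarymx)
  (omega : 'rV[R[i]]_N) (omega_norm : forall i, `|omega 0 i| = 1)
  (FM_spectral :
     map_mx (real_complex R) (harmonic_mx H b) = V *m diag_mx omega *m V^t*)
  (theta : 'I_N -> R) (theta_arg : forall i, omega 0 i = expi (theta i)) :
  forall alpha beta : R,
    frac_mx V theta alpha *m frac_mx V theta beta = frac_mx V theta (alpha + beta).
Proof.
by move=> alpha beta; rewrite frac_mx_mul.
Qed.
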